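(* For every positive integer $n$, $$\sum_{\substack{0\le k\le n\\ k\equiv n\ (\mathrm{mod}\ 2)}}\binom{n}{k}\left(\sqrt{9x^2-y}\right)^{n-k}\left(2^kC_k(x,y)+(6x)^k\right)E_{n-k}=\left(6x+\sqrt{9x^2-y}\right)^n+\left(6x-\sqrt{9x^2-y}\right)^n.$$
   Context: Here $x,y$ are commuting variables (indeterminates) and $\sqrt{9x^2-y}$ denotes a fixed square root of $9x^2-y$ (in an extension field of the field of rational functions in $x,y$). The bivariate Lucas-balancing polynomials are defined by $C_0(x,y)=1$, $C_1(x,y)=3x$, $C_n(x,y)=6xC_{n-1}(x,y)-yC_{n-2}(x,y)$ for $n\ge 2$. The Euler numbers $E_n$ are defined by $\sum_{n\ge 0}E_n\frac{z^n}{n!}=\frac{2e^z}{e^{2z}+1}$. *)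

(* Defs.v *)
From HB Require Import structures.
From mathcomp Require Import all_boot all_order all_algebra.
From mathcomp Require Import fraction mpoly.

Set Implicit Arguments.
Unset Strict Implicit.
Unset Printing Implicit Defensive.

Import Order.TTheory GRing.Theory Num.Theory.
Local Open Scope ring_scope.

(* A formal power series \sum_n a_n z^n is represented by its sequence of
   coefficients a : nat -> F. *)
Section PowerSeries.
Variable F : fieldType.
Implicit Types (a b : nat -> F) (c : F).

Definition ps_const c : nat -> F := fun n => if n is 0 then c else 0.
Definition ps_add a b : nat -> F := fun n => a n + b n.
Definition ps_mul a b : nat -> F :=
  fun n => \sum_(i < n.+1) a i * b (n - i)%N.

(* e^{cz}; meaningful only when F has characteristic 0. *)
Definition ps_exp c : nat -> F := fun n => c ^+ n / n`!%:R.

(* \sum_n a_n z^n / n! *)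
Definition ps_egf a : nat -> F := fun n => a n / n`!%:R.

(* The first n coefficients of 1 / a, by the recurrence
   a_0 b_m = [m = 0] - \sum_(i < m) a_(m - i) b_i. *)
Fixpoint ps_inv_seq a n : seq F :=
  if n is m.+1 then
    let s := ps_inv_seq a m in
    rcons s ((a 0)^-1 * ((m == 0)%:R - \sum_(i < m) a (m - i)%N * s`_i))
  else [::].

(* The inverse of a; meaningful only when a 0 != 0, see ps_divK. *)
Definition ps_inv a : nat -> F := fun n => (ps_inv_seq a n.+1)`_n.
Definition ps_div a b : nat -> F := ps_mul a (ps_inv b).

Lemma size_ps_inv_seq a n : size (ps_inv_seq a n) = n.
Proof. by elim: n => //= n IHn; rewrite size_rcons IHn. Qed.

Lemma nth_ps_inv_seq a n i : (i < n)%N -> (ps_inv_seq a n)`_i = ps_inv a i.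
Proof.
elim: n => // n IHn; rewrite ltnS leq_eqVlt => /predU1P[-> //|lt_in].
by rewrite /= nth_rcons size_ps_inv_seq lt_in IHn.
Qed.

Lemma ps_invE a n :
  ps_inv a n =
    (a 0)^-1 * ((n == 0)%:R - \sum_(i < n) a (n - i)%N * ps_inv a i).
Proof.
rewrite {1}/ps_inv /= nth_rcons size_ps_inv_seq ltnn eqxx.
by congr (_ * (_ - _)); apply: eq_bigr => i _; rewrite nth_ps_inv_seq.
Qed.

Lemma ps_mulVr a : a 0 != 0 -> ps_mul (ps_inv a) a =1 ps_const 1.
Proof.
move=> a0 n; rewrite /ps_mul big_ord_recr /= subnn ps_invE.
rewrite mulrAC mulVf // mul1r addrC.
under [X in _ - X]eq_bigr => i _ do rewrite mulrC.
by rewrite subrK; case: n.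
Qed.

Lemma ps_mulA a b (d : nat -> F) :
  ps_mul (ps_mul a b) d =1 ps_mul a (ps_mul b d).
Proof.
move=> n.
pose p (e : nat -> F) : {poly F} := \poly_(i < n.+1) e i.
have pE e i : (i <= n)%N -> (p e)`_i = e i.
  by move=> le_in; rewrite coef_poly ltnS le_in.
have pM e f i : (i <= n)%N -> (p e * p f)`_i = ps_mul e f i.
  move=> le_in; rewrite coefM; apply: eq_bigr => j _.
  have le_ji : (j <= i)%N by rewrite -ltnS.
  by rewrite !pE ?(leq_trans le_ji) // (leq_trans (leq_subr _ _)).
transitivity ((p a * p b * p d)`_n).
  rewrite coefM; apply: eq_bigr => i _.
  by rewrite pM ?pE ?leq_subr // -ltnS.
rewrite -mulrA coefM; apply: eq_bigr => i _.
by rewrite pM ?pE ?leq_subr // -ltnS.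
Qed.

Lemma ps_divK a b : b 0 != 0 -> ps_mul (ps_div a b) b =1 a.
Proof.
move=> b0 n; rewrite ps_mulA {1}/ps_mul big_ord_recr /= subnn.
rewrite ps_mulVr // mulr1 big1 ?add0r // => i _.
rewrite ps_mulVr //; case: (n - i)%N (subn_gt0 i n) => [|m _] /=.
  by rewrite ltn_ord.
by rewrite mulr0.
Qed.

End PowerSeries.

(* n! times the coefficient of z^n in 2 e^z / (e^{2z} + 1). *)
Definition euler (n : nat) : rat :=
  n`!%:R * ps_div (ps_mul (ps_const 2) (ps_exp 1))
                  (ps_add (ps_exp 2) (ps_const 1)) n.

Lemma egf_euler :
  ps_egf euler =1 ps_div (ps_mul (ps_const 2) (ps_exp 1))
                         (ps_add (ps_exp 2) (ps_const 1)).
Proof.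
by move=> n; rewrite /ps_egf /euler mulrC mulKf // pnatr_eq0 -lt0n fact_gt0.
Qed.

Lemma egf_euler_mul :
  ps_mul (ps_egf euler) (ps_add (ps_exp 2) (ps_const 1))
    =1 ps_mul (ps_const 2) (ps_exp 1).
Proof.
move=> n; rewrite -[RHS](@ps_divK _ _ (ps_add (ps_exp 2) (ps_const 1))) //.
by apply: eq_bigr => i _; rewrite egf_euler.
Qed.

(* The embedding of an integral domain into its field of fractions; the library
   only declares this notation locally. *)
Notation "p %:F" := (@FracField.tofrac _ p) : ring_scope.

Section LucasBalancing.
Variable K : fieldType.

Definition varx : {mpoly K[2]} := 'X_0.
Definition vary : {mpoly K[2]} := 'X_1.

Fixpoint lucas_balancing (n : nat) : {mpoly K[2]} :=
  match n with
  | 0 => 1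
  | 1 => 3 * varx
  | (m.+1 as n').+1 =>
      6 * varx * lucas_balancing n' - vary * lucas_balancing m
  end.

End LucasBalancing.

Arguments varx {K}.
Arguments vary {K}.
Arguments lucas_balancing {K} n.

(* Main.v *)
Require Import Defs.
From HB Require Import structures.
From mathcomp Require Import all_boot all_order all_algebra.
From mathcomp Require Import fraction mpoly.
From mathcomp Require Import ring.

Set Implicit Arguments.
Unset Strict Implicit.
Unset Printing Implicit Defensive.

Import Order.TTheory GRing.Theory Num.Theory.
Local Open Scope ring_scope.

(** Let Λ be the linear functional on polynomials sending X^k to E_k. The
    defining generating function of the Euler numbers says exactly that
    Λ(p(X + 2)) + Λ(p(X)) = 2 p(1). Put w = 6x and q(X) = (w + sX)^n. Since
    2^k C_k is the mean of (w + 2s)^k and (w - 2s)^k, twice the left-hand side,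
    with the parity condition dropped (the odd Euler numbers vanish), is
    Λ(q(X + 2) + q(X)) + Λ(q(X) + q(X - 2)) = 2 q(1) + 2 q(-1). *)

Section Umbral.
Variables (R : idomainType) (e : nat -> R).

Definition umbral (p : {poly R}) : R := \sum_(i < size p) p`_i * e i.

Lemma umbral_widen m (p : {poly R}) :
  (size p <= m)%N -> umbral p = \sum_(i < m) p`_i * e i.
Proof.
move=> le_pm; rewrite /umbral (big_ord_widen m (fun i => p`_i * e i)) //.
rewrite big_mkcond; apply: eq_bigr => i _.
by case: ltnP => // le_pi; rewrite nth_default // mul0r.
Qed.

Fact umbral_is_scalar : scalar umbral.
Proof.
move=> c p q; pose m := maxn (size p) (size q).
have le_pm : (size p <= m)%N by apply: leq_maxl.
have le_qm : (size q <= m)%N by apply: leq_maxr.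
rewrite (umbral_widen le_pm) (umbral_widen le_qm) (@umbral_widen m).
  rewrite mulr_sumr -big_split /=; apply: eq_bigr => i _.
  by rewrite coefD coefZ mulrDl mulrA.
rewrite (leq_trans (size_polyD _ _)) // geq_max le_qm andbT.
exact: leq_trans (size_scale_leq _ _) le_pm.
Qed.

HB.instance Definition _ :=
  GRing.isLinear.Build R {poly R} R _ umbral umbral_is_scalar.

Lemma umbralXn n : umbral 'X^n = e n.
Proof.
rewrite /umbral size_polyXn big_ord_recr /= coefXn eqxx mul1r big1 ?add0r //.
by move=> i _; rewrite coefXn ltn_eqF ?mul0r.
Qed.

Lemma umbral_binomial a b n :
  umbral ((b *: 'X + a%:P) ^+ n) =
  \sum_(k < n.+1) 'C(n, k)%:R * b ^+ (n - k) * a ^+ k * e (n - k).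
Proof.
rewrite exprDn linear_sum; apply: eq_bigr => k _.
rewrite linearMn /= exprZn -polyC_exp mulrC mul_polyC scalerA linearZ /=.
by rewrite umbralXn -mulr_natl; ring.
Qed.

(** This is e(z) (e^{2z} + 1) = 2 e^z at z^n / n!, where e(z) is the exponential generating function
    of [e]. *)
Hypothesis euler_rec : forall n,
  \sum_(k < n.+1) 'C(n, k)%:R * 2 ^+ k * e (n - k) + e n = 2.

(** Both sides are linear in [p], and on the monomial X^i the claim is [euler_rec i]. *)
Lemma umbral_shift (p : {poly R}) :
  umbral (p \Po ('X + 2%:P)) + umbral p = 2 * p.[1].
Proof.
rewrite -[p]coefK poly_def !linear_sum /= horner_sum mulr_sumr -big_split /=.
apply: eq_bigr => i _.
rewrite comp_polyZ comp_Xn_poly !linearZ /= umbralXn -mulrDr.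
rewrite -['X]scale1r umbral_binomial scale1r !hornerE /=.
rewrite expr1n mulr1 mulrC -[2 in RHS](euler_rec i); congr ((_ + _) * _); apply: eq_bigr => k _.
by rewrite expr1n mulr1.
Qed.

Lemma umbral_shift_affine a b n :
  umbral ((b *: 'X + (a + 2 * b)%:P) ^+ n) + umbral ((b *: 'X + a%:P) ^+ n)
  = 2 * (a + b) ^+ n.
Proof.
have := umbral_shift ((b *: 'X + a%:P) ^+ n).
rewrite rmorphXn /= comp_polyD comp_polyZ comp_polyX comp_polyC.
rewrite horner_exp !hornerE addrC [b + a]addrC => <-.
rewrite addrC; congr (umbral (_ ^+ n) + _).
by rewrite -!mul_polyC polyCD polyCM; ring.
Qed.

Hypothesis two_neq0 : 2 != 0 :> R.

(* Shifting by -2 shows that (-1)^n e_n obeys the same recurrence as e_n. *)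
Lemma euler_rec_sign n : (-1) ^+ n * e n = e n.
Proof.
elim/ltn_ind: n => n IHn; apply: (mulfI two_neq0).
have Hpos := euler_rec n.
(* With a = -2 and b = 1 the shifted base is X itself, which gives Λ(X^n) + Λ((X - 2)^n) = 2
   (-1)^n. *)
have := umbral_shift_affine (-2) 1 n.
rewrite mulr1 addNr addr0 scale1r umbralXn -['X]scale1r umbral_binomial.
have -> : (-2 + 1) = -1 :> R by ring.
move=> Hneg.
have sgn2 k : (-1) ^+ k * (-1) ^+ k = 1 :> R by rewrite -expr2 sqrr_sign.
move: Hpos Hneg; rewrite !big_ord_recl /= !subn0 !expr0 bin0 !expr1n !mulr1.
rewrite !mul1r => Hpos Hneg.
(* The terms k = 0, equal to [e n], are split off, so [S] and [T] involve only smaller indices and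
   the induction hypothesis applies to each of their terms. *)
set S := \sum_(i < n) _ in Hpos; set T := \sum_(i < n) _ in Hneg.
have ST : T = (-1) ^+ n * S.
  rewrite /S /T mulr_sumr; apply: eq_bigr => i _.
  rewrite /bump /= add1n expr1n mulr1.
  have lt_in := ltn_ord i.
  rewrite -[e _ in RHS]IHn ?ltn_subrL //; last exact: leq_ltn_trans lt_in.
  have -> : (-1) ^+ n = (-1) ^+ (n - i.+1) * (-1) ^+ i.+1 :> R.
    by rewrite -exprD subnK.
  rewrite [(-2) ^+ _]exprNn.
  transitivity (((-1) ^+ (n - i.+1) * (-1) ^+ (n - i.+1)) *
     ('C(n, i.+1)%:R * ((-1) ^+ i.+1 * 2 ^+ i.+1) * e (n - i.+1))).
    by rewrite sgn2 mul1r.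
  by ring.
have -> : 2 * ((-1) ^+ n * e n) = (-1) ^+ n * (e n + S + e n) - (-1) ^+ n * S.
  by ring.
rewrite Hpos -ST mulrC -Hneg; ring.
Qed.

Lemma euler_rec_odd n : odd n -> e n = 0.
Proof.
move=> odd_n; apply: (mulfI two_neq0); have := euler_rec_sign n.
rewrite -signr_odd odd_n expr1 mulN1r mulr0 mulr_natl mulr2n => {1}<-.
by rewrite addNr.
Qed.

End Umbral.

Lemma euler_recE n :
  \sum_(k < n.+1) 'C(n, k)%:R * 2 ^+ k * euler (n - k) + euler n = 2.
Proof.
have fact_neq0 m : m`!%:R != 0 :> rat by rewrite pnatr_eq0 -lt0n fact_gt0.
have /(congr1 ( *%R n`!%:R)) := egf_euler_mul n.
have -> : ps_mul (ps_const 2) (ps_exp 1) n = 2 / n`!%:R :> rat.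
  rewrite /ps_mul big_ord_recl /= subn0 /ps_exp expr1n mul1r big1 ?addr0 //.
  by move=> i _; rewrite mul0r.
rewrite mulrCA mulfV // mulr1 => egf_n; rewrite -[RHS]egf_n.
(* Reversing the Cauchy product makes k the exponent from e^{2z}; the constant series 1 then
   contributes only at k = 0, whence the indicator below. *)
rewrite /ps_mul [in RHS](reindex_inj rev_ord_inj) /= [RHS]mulr_sumr.
under [RHS]eq_bigr => k _ do rewrite subSS.
rewrite [RHS](_ : _ = \sum_(k < n.+1)
  ('C(n, k)%:R * 2 ^+ k * euler (n - k) + (k == 0 :> nat)%:R * euler n)).
  rewrite big_split /=; congr (_ + _).
  rewrite big_ord_recl /= mul1r big1 ?addr0 // => i _; exact: mul0r.
apply: eq_bigr => k _; have le_kn : (k <= n)%N by rewrite -ltnS.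
rewrite /ps_add /ps_egf /ps_exp subKn // !mulrDr; congr (_ + _).
  rewrite -(bin_fact le_kn) !natrM; field.
  by rewrite !fact_neq0.
case: (nat_of_ord k) => [|j] /=; last by rewrite mul0r !mulr0.
by rewrite subn0 mulr1 mul1r mulrC mulfVK.
Qed.

(** In the recurrence for 2 E_n every term with k > 0 carries the even factor 2^k, so halving stays
    within the integers. *)
Lemma euler_int n : euler n \is a Num.int.
Proof.
elim/ltn_ind: n => n IHn; have := euler_recE n.
rewrite big_ord_recl /= subn0 bin0 expr0 !mul1r => rec_n.
have -> : euler n = 1 - \sum_(k < n)
    'C(n, k.+1)%:R * 2 ^+ k * euler (n - k.+1).
  apply: (@mulfI _ (2 : rat)) => //; rewrite mulrBr mulr1 -[X in X - _]rec_n mulr_sumr.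
  rewrite [X in _ + X + _ - _](eq_bigr (fun k : 'I_n =>
    2 * ('C(n, k.+1)%:R * 2 ^+ k * euler (n - k.+1)))); last first.
    by move=> k _; rewrite /bump /= add1n exprS; ring.
  by ring.
rewrite rpredB ?rpred1 // rpred_sum // => k _.
apply: rpredM; first by rewrite rpredM ?rpredX ?rpred_nat.
by apply: IHn; rewrite ltn_subrL /=; apply: leq_ltn_trans (ltn_ord k).
Qed.

(* [ratr] is a ring morphism only into characteristic 0; integrality of the
   Euler numbers makes the transfer valid in any field. *)
Lemma ratr_euler_rec (L : fieldType) n :
  \sum_(k < n.+1) 'C(n, k)%:R * 2 ^+ k * ratr (euler (n - k)) + ratr (euler n)
  = 2 :> L.
Proof.
have eulerE m : euler m = (numq (euler m))%:~R.
  by rewrite -[in LHS](numqK (euler_int m)).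
have ratrE m : ratr (euler m) = (numq (euler m))%:~R :> L.
  by rewrite [in LHS]eulerE ratr_int.
have rec_int : \sum_(k < n.+1) 'C(n, k)%:R * 2 ^+ k * numq (euler (n - k))
    + numq (euler n) = 2 :> int.
  apply: (@intr_inj rat); rewrite rmorphD rmorph_sum /= -eulerE.
  rewrite -[RHS](euler_recE n); congr (_ + _); apply: eq_bigr => k _.
  by rewrite !rmorphM rmorphXn !rmorph_nat /= -eulerE.
have /(congr1 (fun z : int => z%:~R : L)) := rec_int.
rewrite /= rmorphD rmorph_sum /= => rec_L; rewrite -[RHS]rec_L ratrE.
congr (_ + _); apply: eq_bigr => k _.
by rewrite !rmorphM rmorphXn !rmorph_nat /= -ratrE.
Qed.

(** The roots of t^2 - 6xt + y are 3x + s and 3x - s, so both sides obey the same second-order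
    recurrence. *)
Lemma lucas_balancing_binet (K L : fieldType)
    (f : {rmorphism {mpoly K[2]} -> L}) (s : L) k :
  s ^+ 2 = f (9 * varx ^+ 2 - vary) ->
  2 * f (lucas_balancing k) =
  (3 * f varx + s) ^+ k + (3 * f varx - s) ^+ k.
Proof.
rewrite rmorphB rmorphM rmorphXn rmorph_nat /= => hs.
have fy : f vary = 9 * f varx ^+ 2 - s ^+ 2 by rewrite hs; ring.
elim/ltn_ind: k => -[|[|k]] IHk.
- by rewrite /= rmorph1 !expr0 mulr1.
- by rewrite /= rmorphM rmorph_nat !expr1; ring.
have -> : lucas_balancing k.+2 =
  6 * varx * lucas_balancing k.+1 - vary * lucas_balancing k :> {mpoly K[2]}.
  by [].
rewrite rmorphB !rmorphM rmorph_nat mulrBr ![2 * (_ * f _)]mulrCA.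
by rewrite !IHk // fy !exprS; ring.
Qed.

(** Characteristic 0 passes from [K] to [L] along injective morphisms; this permits cancelling 2 in
    [L]. *)
Lemma natr_fraction_mpoly_neq0 (K L : fieldType) m
    (f : {rmorphism {fraction {mpoly K[m]}} -> L}) n :
  [pchar K] =i pred0 -> (0 < n)%N -> n%:R != 0 :> L.
Proof.
move=> charK n_gt0; rewrite -(rmorph_nat f) fmorph_eq0.
rewrite -(rmorph_nat (@FracField.tofrac {mpoly K[m]})) tofrac_eq0.
rewrite -(rmorph_nat (@mpolyC m K)) mpolyC_eq0.
by rewrite ((pcharf0P K).1 charK) -lt0n.
Qed.

Theorem corollary18 (K : fieldType) (charK : [pchar K] =i pred0)
    (L : fieldType) (iota : {rmorphism {fraction {mpoly K[2]}} -> L})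
    (s : L) (hs : s ^+ 2 = iota (9 * varx ^+ 2 - vary)%:F)
    (n : nat) (hn : (0 < n)%N) :
  \sum_(0 <= k < n.+1 | k == n %[mod 2])
      'C(n, k)%:R * s ^+ (n - k)
      * (2 ^+ k * iota (lucas_balancing k)%:F + (6 * iota varx%:F) ^+ k)
      * ratr (euler (n - k))
  = (6 * iota varx%:F + s) ^+ n + (6 * iota varx%:F - s) ^+ n.
Proof.
have two_neq0 : 2 != 0 :> L by exact: (natr_fraction_mpoly_neq0 iota).
pose e m : L := ratr (euler m).
have rec_e := @ratr_euler_rec L : forall m,
  \sum_(k < m.+1) 'C(m, k)%:R * 2 ^+ k * e (m - k)%N + e m = 2.
pose w := 6 * iota varx%:F.
(* The factor 2^k doubles the roots to w + 2s and w - 2s, the constant terms of q(X + 2) and q(X -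
   2). *)
have binet k : 2 * (2 ^+ k * iota (lucas_balancing k)%:F) =
    (w + 2 * s) ^+ k + (w + - (2 * s)) ^+ k.
  rewrite mulrCA.
  rewrite (@lucas_balancing_binet _ _ (iota \o @FracField.tofrac _) s) //=.
  rewrite mulrDr -!exprMn /w; congr (_ ^+ k + _ ^+ k); ring.
apply: (mulfI two_neq0).
(* Λ(q) occurs twice because it has to supply the doubled term 2 (6x)^k. *)
transitivity (umbral e ((s *: 'X + (w + 2 * s)%:P) ^+ n)
  + umbral e ((s *: 'X + w%:P) ^+ n) + (umbral e ((s *: 'X + w%:P) ^+ n)
  + umbral e ((s *: 'X + (w + - (2 * s))%:P) ^+ n))); last first.
  rewrite umbral_shift_affine //.
  have := umbral_shift_affine rec_e (w + - (2 * s)) s n.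
  rewrite addrNK => ->; rewrite -mulrDr; rewrite -/w.
  by congr (2 * (_ ^+ n + _ ^+ n)); ring.
rewrite !umbral_binomial -!big_split /= big_mkcond big_mkord mulr_sumr.
apply: eq_bigr => k _; have le_kn : (k <= n)%N by rewrite -ltnS.
case: ifPn => [_|neq_kn].
  rewrite -/(e _) -/w; transitivity ('C(n, k)%:R * s ^+ (n - k) *
    (2 * (2 ^+ k * iota (lucas_balancing k)%:F) + 2 * w ^+ k) * e (n - k)%N).
    by ring.
  by rewrite binet; ring.
(* Here n - k is odd, so the terms missing from the parity-restricted sum are zero. *)
rewrite (@euler_rec_odd _ _ rec_e two_neq0 (n - k)) ?mulr0 ?addr0 //.
by rewrite oddB //; move: neq_kn; rewrite !modn2; do 2!case: odd.
Qed.
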